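(* Let $(X,T)$ be an invertible t.d.s. The following statements are equivalent: (1) $(X,T)$ is uniformly rigid; (2) $(K(X),T_K)$ is uniformly rigid; (3) $(K(X),T_K)$ is rigid; (4) $(K(X),T_K)$ is weakly rigid; (5) the system induced by $T_K$ on $K(K(X))$, i.e. $(K(K(X)),(T_K)_K)$, is pointwise recurrent.
   Context: A t.d.s. is a pair $(X,T)$ with $X$ a compact metric space and $T:X\to X$ a continuous surjective map; it is invertible if $T$ is a homeomorphism. $K(X)$ is the set of non-empty closed subsets of $X$ with the Hausdorff metric, and $T_K:K(X)\to K(X)$, $T_K(A)=T(A)$; $(K(X),T_K)$ is again a t.d.s., invertible if $(X,T)$ is. The same construction applied to $(K(X),T_K)$ gives $(K(K(X)),(T_K)_K)$. The following notions apply to any invertible t.d.s. $(X,T)$. A point $x$ is recurrent if there is a sequence of integers $n_i\to+\infty$ or a sequence $n_i\to-\infty$ with $T^{n_i}x\to x$. $(X,T)$ is pointwise recurrent if every point is recurrent. $(X,T)$ is weakly rigid if for each $n\in\mathbb{N}=\{1,2,\dots\}$ every point of $X^n$ is recurrent for $T^{(n)}=T\times\cdots\times T$ ($n$ times). $(X,T)$ is rigid (resp. uniformly rigid) if there is a sequence of positive integers $m_i\to\infty$ with $T^{m_i}\to\mathrm{id}$ pointwise (resp. uniformly). *)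

(* Defs.v *)
From HB Require Import structures.
From mathcomp Require Import all_boot all_order all_algebra.
From mathcomp Require Import all_classical all_reals all_analysis.
From mathcomp Require Import lra.

Set Implicit Arguments.
Unset Strict Implicit.
Unset Printing Implicit Defensive.

Import Order.TTheory GRing.Theory Num.Theory.
Import numFieldNormedType.Exports.

Local Open Scope classical_set_scope.
Local Open Scope ring_scope.

HB.mixin Record Metric_isCompact (R : realType) M & Metric R M := {
  compactT : compact [set: M]
}.

#[short(type="compactMetricType")]
HB.structure Definition CompactMetric (R : realType) :=
  { M of Metric R M & Metric_isCompact R M }.

Section Hausdorff_distance.
Context {R : realType} {X : metricType R}.

Definition set_dist (x : X) (A : set X) : R := inf [set mdist x a | a in A].

Definition excess (A B : set X) : R := sup [set set_dist a B | a in A].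

Definition hausdorff_dist (A B : set X) : R :=
  Num.max (excess A B) (excess B A).

Lemma set_dist_le (x : X) (A : set X) a : A a -> set_dist x A <= mdist x a.
Proof.
move=> Aa; apply: ge_inf; last by exists a.
by exists 0 => _ [y _ <-]; exact: mdist_ge0.
Qed.

Lemma set_dist_ge0 (x : X) (A : set X) : A !=set0 -> 0 <= set_dist x A.
Proof.
move=> [a Aa]; apply: lb_le_inf; first by exists (mdist x a); exists a.
by move=> _ [y _ <-]; exact: mdist_ge0.
Qed.

Lemma set_dist_lt (x : X) (A : set X) e : A !=set0 -> set_dist x A < e ->
  exists2 a, A a & mdist x a < e.
Proof.
move=> [a Aa] xAe.
have xA0 : [set mdist x b | b in A] !=set0 by exists (mdist x a); exists a.
by have [_ [y Ay <-] ye] := inf_lt xA0 xAe; exists y.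
Qed.

End Hausdorff_distance.

(** K(X).  The metric instance below is [hausdorff_dist]; it needs [X] compact,
    since [sup] is [0] on unbounded sets. *)
Record hyperspace (X : topologicalType) := Hyperspace {
  hset :> set X;
  hset_closed : closed hset;
  hset_nonempty : hset !=set0
}.
Arguments hset_closed {X} _.

Lemma hyperspace_eq (X : topologicalType) (A B : hyperspace X) :
  hset A = hset B -> A = B.
Proof.
case: A B => [A cA A0] [B cB B0] /= AB; rewrite AB in cA A0 *.
by rewrite (Prop_irrelevance cA cB) (Prop_irrelevance A0 B0).
Qed.

HB.instance Definition _ (X : topologicalType) := gen_eqMixin (hyperspace X).
HB.instance Definition _ (X : topologicalType) :=
  gen_choiceMixin (hyperspace X).

Section hyperspace_metric.
Context {R : realType} {X : compactMetricType R}.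
Implicit Types (x y : X) (A B C : hyperspace X).

Lemma mdist_bounded : exists M : R, forall x y, mdist x y <= M.
Proof.
have [[x0 _]|X0] := pselect ([set: X] !=set0); last first.
  by exists 0 => x; exfalso; apply: X0; exists x.
have /compact_near_coveringP cX := @compactT R X.
have [N _ HN] : \forall n \near \oo, forall x, [set: X] x -> mdist x0 x <= n%:R.
  apply: cX => x _; near=> x' n => /=.
  rewrite (le_trans (metric_triangle _ x _))//.
  apply: (@le_trans _ _ (mdist x0 x + 1)).
    rewrite lerD2l ltW//.
    have : ball x 1 x' by near: x'; exact: nbhsx_ballx.
    by rewrite ballEmdist.
  by near: n; exact: nbhs_infty_ger.
exists (N%:R + N%:R) => x y; rewrite (le_trans (metric_triangle _ x0 _))//.
by rewrite lerD//; [rewrite metric_sym|]; exact: (HN N (leqnn N) _ I).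
Unshelve. all: by end_near. Qed.

Lemma excess_has_ubound A B : has_ubound [set set_dist a B | a in hset A].
Proof.
have [M HM] := mdist_bounded; exists M => _ [a Aa <-].
have [b Bb] := hset_nonempty B.
exact: le_trans (set_dist_le a Bb) (HM _ _).
Qed.

Lemma set_dist_le_excess A B x : hset A x -> set_dist x B <= excess A B.
Proof. by move=> Ax; apply: ub_le_sup; [exact: excess_has_ubound|exists x]. Qed.

Lemma excess_le A B e :
  (forall x, hset A x -> exists2 y, hset B y & mdist x y <= e) -> excess A B <= e.
Proof.
move=> H; apply: ge_sup => [|_ [a Aa <-]].
  by have [a Aa] := hset_nonempty A; exists (set_dist a B); exists a.
by have [b Bb abe] := H _ Aa; exact: le_trans (set_dist_le a Bb) abe.
Qed.

Lemma hausdorff_dist_le A B e :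
  (forall x, hset A x -> exists2 y, hset B y & mdist x y <= e) ->
  (forall y, hset B y -> exists2 x, hset A x & mdist y x <= e) ->
  hausdorff_dist A B <= e.
Proof. by move=> H1 H2; rewrite /hausdorff_dist ge_max !excess_le. Qed.

Lemma hausdorff_dist_sym A B : hausdorff_dist A B = hausdorff_dist B A.
Proof. by rewrite /hausdorff_dist maxC. Qed.

Lemma hausdorff_dist_lt A B e x : hausdorff_dist A B < e -> hset A x ->
  exists2 y, hset B y & mdist x y < e.
Proof.
rewrite /hausdorff_dist gt_max => /andP[ABe _] Ax.
apply: set_dist_lt; first exact: hset_nonempty.
exact: le_lt_trans (set_dist_le_excess B Ax) ABe.
Qed.

Lemma hausdorff_distxx A : hausdorff_dist A A = 0.
Proof.
apply/eqP; rewrite eq_le; apply/andP; split.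
  by apply: hausdorff_dist_le => x Ax; exists x; rewrite // mdistxx.
rewrite /hausdorff_dist maxxx; have [x Ax] := hset_nonempty A.
exact: le_trans (set_dist_ge0 x (hset_nonempty A)) (set_dist_le_excess A Ax).
Qed.

Lemma hausdorff_dist_positivity A B : hausdorff_dist A B = 0 -> A = B.
Proof.
suff sub (C D : hyperspace X) : hausdorff_dist C D = 0 -> hset C `<=` D.
  move=> AB0; apply: hyperspace_eq; apply/seteqP; split; apply: sub => //.
  by rewrite hausdorff_dist_sym.
move=> CD0 x Cx; apply: (hset_closed D) => V.
rewrite -nbhs_ballE => -[e /= e0 eV].
have [|y Dy xye] := @hausdorff_dist_lt C D e x _ Cx; first by rewrite CD0.
by exists y; split => //; apply: eV; rewrite ballEmdist.
Qed.

Lemma hausdorff_dist_triangle B A C :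
  hausdorff_dist A C <= hausdorff_dist A B + hausdorff_dist B C.
Proof.
apply/ler_addgt0Pl => e e0; have e20 : 0 < e / 2 by rewrite divr_gt0.
have H (D1 D2 D3 : hyperspace X) x : hset D1 x -> exists2 y, hset D3 y &
    mdist x y <= e + (hausdorff_dist D1 D2 + hausdorff_dist D2 D3).
  move=> D1x.
  have [|y D2y xy] := @hausdorff_dist_lt D1 D2 (hausdorff_dist D1 D2 + e / 2) x _ D1x.
    by rewrite ltrDl.
  have [|z D3z yz] := @hausdorff_dist_lt D2 D3 (hausdorff_dist D2 D3 + e / 2) y _ D2y.
    by rewrite ltrDl.
  by exists z => //; have := metric_triangle x y z; lra.
apply: hausdorff_dist_le => x Hx; first exact: H.
rewrite [X in e + X]addrC (hausdorff_dist_sym B C) (hausdorff_dist_sym A B).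
exact: H.
Qed.

HB.instance Definition _ := @isMetric.Build R (hyperspace X)
  (fun A B => hausdorff_dist A B) hausdorff_distxx hausdorff_dist_positivity
  hausdorff_dist_sym hausdorff_dist_triangle.

Lemma mdist_hyperspace A B : mdist A B = hausdorff_dist A B.
Proof. by []. Qed.

Lemma hyperspace_compact_subproof : compact [set: hyperspace X].
Proof.
have /compact_near_coveringP cX := @compactT R X.
rewrite compact_ultra => U UU _.
pose hit x e := [set K : hyperspace X | exists2 y, hset K y & mdist x y < e].
pose L := [set x | forall e, 0 < e -> U (hit x e)].
have notL x : ~ L x ->
    exists2 e, 0 < e & U [set K | forall y, hset K y -> ~ mdist x y < e].
  move=> /existsNP[e /not_implyP[e0 /=]].
  have [//|] := in_ultra_setVsetC (hit x e) UU; move=> Uc _; exists e => //.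
  by apply: filterS Uc => K /= nK y Ky xy; apply: nK; exists y.
have L0 : L !=set0.
  apply: contrapT => nL.
  have : \forall K \near U, forall x, [set: X] x -> ~ hset K x.
    apply: cX => x _.
    have [|e e0 Ue] := notL x; first by move=> Lx; apply: nL; exists x.
    near=> x' K => /= Kx'.
    apply: ((near Ue K _) x' Kx') => //.
    have : ball x e x' by near: x'; exact: nbhsx_ballx.
    by rewrite ballEmdist.
  by move=> /filter_ex[K nK]; have [x Kx] := hset_nonempty K; exact: (nK x).
have cL : closed L.
  move=> x clx e e0; have e20 : 0 < e / 2 by rewrite divr_gt0.
  have [y [Ly]] := clx _ (nbhsx_ballx x _ e20); rewrite ballEmdist/= => xy.
  apply: filterS (Ly _ e20) => K [z Kz yz]; exists z => //.
  by have := metric_triangle x y z; lra.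
exists (Hyperspace cL L0); split => //.
apply/metricType_numDomainType.fcvgrPdist_lt => e e0.
have e20 : 0 < e / 2 by rewrite divr_gt0.
have cpL : compact L by exact: subclosed_compact cL (@compactT R X) _.
have near1 : \forall K \near U, forall x, L x ->
    exists2 y, hset K y & mdist x y <= e / 2.
  move/compact_near_coveringP : cpL; apply => x Lx.
  have e40 : 0 < e / 4 by rewrite divr_gt0.
  have Ux := Lx _ e40; near=> x' K.
  have [y Ky xy] : hit x (e / 4) K by exact: (near Ux K _).
  have : ball x (e / 4) x' by near: x'; exact: nbhsx_ballx.
  rewrite ballEmdist/= => xx'; exists y => //.
  by have := metric_triangle x' x y; rewrite (metric_sym x' x); lra.
have near2 : \forall K \near U, forall y, [set: X] y -> hset K y ->
    exists2 x, L x & mdist y x <= e / 2.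
  apply: cX => x _; have [Lx|/notL[r r0 Ur]] := pselect (L x).
    near=> x' K => _; exists x => //; rewrite metric_sym ltW//.
    have : ball x (e / 2) x' by near: x'; exact: nbhsx_ballx.
    by rewrite ballEmdist.
  near=> x' K => /= Kx'; exfalso; apply: ((near Ur K _) x' Kx') => //.
  have : ball x r x' by near: x'; exact: nbhsx_ballx.
  by rewrite ballEmdist.
near=> K; rewrite mdist_hyperspace (@le_lt_trans _ _ (e / 2))//; last by lra.
apply: hausdorff_dist_le => /= x.
  by move: x; exact: (near near1 K _).
by move=> Kx; exact: (near near2 K _).
Unshelve. all: by end_near. Qed.

HB.instance Definition _ :=
  Metric_isCompact.Build R (hyperspace X) hyperspace_compact_subproof.

End hyperspace_metric.

(** With [X : compactMetricType R], the pair of [X] and [T : homeo X] is an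
    invertible topological dynamical system (surjectivity follows from [hinvK]).
    The dynamical notions only use the topology or the uniformity of [X], so they
    also apply to powers of [X] with the product topology. *)
Record homeo (X : topologicalType) := Homeo {
  hfun :> X -> X;
  hinv : X -> X;
  hfunK : cancel hfun hinv;
  hinvK : cancel hinv hfun;
  hfun_continuous : continuous hfun;
  hinv_continuous : continuous hinv
}.
Arguments hfun_continuous {X} _.
Arguments hinv_continuous {X} _.

(** [iterz T k] is T^k; recall that [Negz n] is the integer -(n+1). *)
Definition iterz (X : topologicalType) (T : homeo X) (k : int) : X -> X :=
  match k with
  | Posz n => iter n T
  | Negz n => iter n.+1 (hinv T)
  end.

Section product_homeo.
Context {X : topologicalType}.

Definition prod_map (n : nat) (f : X -> X) :
  {ptws 'I_n -> X} -> {ptws 'I_n -> X} := fun x i => f (x i).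

Lemma prod_map_continuous n f : continuous f -> continuous (prod_map (n := n) f).
Proof.
move=> cf x; have FF := @fmap_filter _ _ (prod_map f) _ (nbhs_filter x).
apply/cvg_sup => i U [_ [[B oB <-] Bx] BU].
apply: (filterS BU).
have xi : (y : {ptws 'I_n -> X}) i @[y --> x] --> x i.
  exact: (@proj_continuous _ (fun=> X) i x).
exact: (cvg_comp _ _ xi (cf (x i))) (open_nbhs_nbhs (conj oB Bx)).
Qed.

Lemma prod_mapK n f g : cancel f g -> cancel (prod_map (n := n) f) (prod_map g).
Proof. by move=> fK x; apply/funext => i; rewrite /prod_map fK. Qed.

Definition prod_homeo (n : nat) (T : homeo X) : homeo {ptws 'I_n -> X} :=
  Homeo (prod_mapK (hfunK T)) (prod_mapK (hinvK T))
    (prod_map_continuous (hfun_continuous T))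
    (prod_map_continuous (hinv_continuous T)).

End product_homeo.

Section hyperspace_homeo.
Context {R : realType} {X : compactMetricType R}.

Lemma image_closed (f : X -> X) (cf : continuous f) (A : hyperspace X) :
  closed (f @` A).
Proof.
apply: compact_closed; first exact: metric_hausdorff.
apply: continuous_compact; first exact: continuous_subspaceT.
exact: subclosed_compact (hset_closed A) (@compactT R X) _.
Qed.

Definition hyperspace_map (f : X -> X) (cf : continuous f) (A : hyperspace X) :
    hyperspace X :=
  Hyperspace (image_closed cf (A := A)) (image_nonempty f (hset_nonempty A)).

Lemma hyperspace_map_continuous f (cf : continuous f) :
  continuous (hyperspace_map cf).
Proof.
move=> A; apply/(@metricType_numDomainType.cvgrPdist_le _ _ _ _ (nbhs_filter A)).
move=> e e0.
have e20 : 0 < e / 2 by rewrite divr_gt0.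
have [d d0 Hd] : exists2 d : R, 0 < d &
    forall x y, mdist x y < d -> mdist (f x) (f y) <= e.
  have : \forall d \near 0^'+, forall x, [set: X] x ->
      forall y, mdist x y < d -> mdist (f x) (f y) <= e.
    have /compact_near_coveringP := @compactT R X; apply => x _.
    have : \forall y \near x, mdist (f x) (f y) < e / 2.
      exact: (metricType_numDomainType.cvgr_dist_lt (cf x)).
    move=> /nbhs_ballP[r /= r0]; rewrite ballEmdist => Hr.
    have r20 : 0 < r / 2 by rewrite divr_gt0.
    near=> x' d => y /= x'y.
    have : ball x (r / 2) x' by near: x'; exact: nbhsx_ballx.
    rewrite ballEmdist/= => xx'.
    have dr : d < r / 2 by near: d; exact: nbhs_right_lt.
    have fx' : mdist (f x) (f x') < e / 2 by apply: Hr => /=; lra.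
    have fy : mdist (f x) (f y) < e / 2.
      by apply: Hr => /=; have := metric_triangle x x' y; lra.
    by have := metric_triangle (f x') (f x) (f y); rewrite (metric_sym (f x') (f x)); lra.
  move=> H; near (0 : R)^'+ => d; exists d; first by near: d; exact: nbhs_right_gt.
  by move=> x; apply: (near H d).
near=> B.
have AB : mdist A B < d.
  have : ball A d B by near: B; exact: nbhsx_ballx.
  by rewrite ballEmdist.
rewrite mdist_hyperspace; rewrite mdist_hyperspace in AB.
apply: hausdorff_dist_le => _ /= [x Hx <-].
  have [y By xy] := hausdorff_dist_lt AB Hx.
  by exists (f y); [exists y|exact: Hd].
rewrite hausdorff_dist_sym in AB.
have [y Ay xy] := hausdorff_dist_lt AB Hx.
by exists (f y); [exists y|exact: Hd].
Unshelve. all: by end_near. Qed.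

Lemma hyperspace_mapK f g (cf : continuous f) (cg : continuous g) :
  cancel f g -> cancel (hyperspace_map cf) (hyperspace_map cg).
Proof.
move=> fK A; apply: hyperspace_eq => /=; rewrite image_comp.
by rewrite (_ : g \o f = id) ?image_id//; apply/funext => x /=; rewrite fK.
Qed.

Definition hyperspace_homeo (T : homeo X) : homeo (hyperspace X) :=
  Homeo
    (hyperspace_mapK (hfun_continuous T) (hinv_continuous T) (hfunK T))
    (hyperspace_mapK (hinv_continuous T) (hfun_continuous T) (hinvK T))
    (@hyperspace_map_continuous _ (hfun_continuous T))
    (@hyperspace_map_continuous _ (hinv_continuous T)).

End hyperspace_homeo.

Section recurrence.
Context {X : topologicalType} (T : homeo X).

Definition recurrent (x : X) : Prop := exists n : nat -> int,
  ((forall M, \forall i \near \oo, M <= n i) \/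
   (forall M, \forall i \near \oo, n i <= M)) /\
  iterz T (n i) x @[i --> \oo] --> x.

Definition pointwise_recurrent : Prop := forall x, recurrent x.

End recurrence.

Definition weakly_rigid (X : topologicalType) (T : homeo X) : Prop :=
  forall n : nat, (0 < n)%N -> pointwise_recurrent (prod_homeo n T).

Definition rigid (X : topologicalType) (T : homeo X) : Prop :=
  exists m : nat -> nat, [/\ forall i, (0 < m i)%N, m i @[i --> \oo] --> \oo &
    forall x, iter (m i) T x @[i --> \oo] --> x].

Definition uniformly_rigid (X : uniformType) (T : homeo X) : Prop :=
  exists m : nat -> nat, [/\ forall i, (0 < m i)%N, m i @[i --> \oo] --> \oo &
    {uniform, (fun i => iter (m i) T) @ \oo --> (id : X -> X)}].

(* Main.v *)
(** Since [T_K] acts on a finite cover of [X] by small closed balls, a time that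
    moves every ball of the cover little also moves every point little: this
    turns simultaneous recurrence of finitely many points of [K(X)] into uniform
    rigidity. Weak rigidity provides such times directly. If only [K(K(X))] is
    pointwise recurrent, let [S] be a finite subset of [K(X)]: times [n] with
    [T^n S] close to [S] may permute [S], but along a subfamily the permutation
    is a fixed [tau], and composing [#[tau]] such times returns every point of
    [S] near itself. *)
Require Import Defs.
From mathcomp Require Import all_boot all_order all_algebra all_fingroup.
From mathcomp Require Import all_classical all_reals all_analysis.
From mathcomp Require Import lra.

Set Implicit Arguments.
Unset Strict Implicit.
Unset Printing Implicit Defensive.

Import Order.TTheory GRing.Theory Num.Theory.
Import numFieldNormedType.Exports.

Local Open Scope classical_set_scope.
Local Open Scope ring_scope.

(** * Return times and recurrence *)

Definition uniform_return (R : realType) (X : metricType R) (f : X -> X) :=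
  forall e : R, 0 < e -> exists2 n, (0 < n)%N & forall x, mdist x (iter n f x) < e.

Definition simultaneous_return (R : realType) (X : metricType R) (f : X -> X)
    (s : seq X) :=
  forall e : R, 0 < e ->
  exists2 n, (0 < n)%N & forall x, x \in s -> mdist x (iter n f x) < e.

Lemma iter_prod_map (X : topologicalType) n (f : X -> X) k
    (x : {ptws 'I_n -> X}) i :
  iter k (prod_map f) x i = iter k f (x i).
Proof. by elim: k => //= k <-. Qed.

Lemma iter_cancel (X : Type) (f g : X -> X) n :
  cancel f g -> cancel (iter n f) (iter n g).
Proof.
by move=> fK; elim: n => // n IHn x; rewrite iterSr [iter n.+1 f x]/= fK IHn.
Qed.

(** Negative times of [T] are positive times of [hinv T]. The disjunction stands outside the
    neighbourhoods, so one direction of time serves all of them. *)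
Lemma recurrent_return (X : topologicalType) (T : homeo X) (x : X) :
  recurrent T x ->
  (forall V, nbhs x V -> exists2 n, (0 < n)%N & V (iter n T x)) \/
  (forall V, nbhs x V -> exists2 n, (0 < n)%N & V (iter n (hinv T) x)).
Proof.
move=> [n [[ny|nNy] nx]]; [left|right] => V Vx.
- have [i []] : exists i, 1 <= n i /\ V (iterz T (n i) x).
    apply: (@filter_ex _ _ (eventually_filter : ProperFilter \oo)).
    exact: (filterI (ny 1) (nx V Vx)).
  by case: (n i) => // k k0 Vk; exists k.
- have [i []] : exists i, n i <= -1 /\ V (iterz T (n i) x).
    apply: (@filter_ex _ _ (eventually_filter : ProperFilter \oo)).
    exact: (filterI (nNy (-1)) (nx V Vx)).
  by case: (n i) => // k k0 Vk; exists k.+1.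
Qed.

Lemma cvgny_int (m : nat -> nat) : m i @[i --> \oo] --> \oo ->
  forall M : int, \forall i \near \oo, M <= Posz (m i).
Proof.
move=> /cvgnyPge my [M|M]; last exact: nearW.
by apply: filterS (my M) => i; rewrite lez_nat.
Qed.

(** Convergence in [{ptws 'I_n -> X}] is coordinatewise, so one rigidity sequence serves every point
    of every power. *)
Lemma rigid_weakly_rigid (X : topologicalType) (T : homeo X) :
  rigid T -> weakly_rigid T.
Proof.
move=> [m [m0 my mT]] n n0 x; exists (fun i => Posz (m i)); split.
  by left; exact: cvgny_int.
apply/cvg_sup => i U [_ [[B oB <-] Bx] BU]; apply: (filterS BU).
have VB : \forall k \near \oo, B (iter (m k) T (x i)).
  exact: mT (open_nbhs_nbhs (conj oB Bx)).
by apply: filterS VB => k /=; rewrite -(iter_prod_map (n := n)).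
Qed.

Lemma rigid_pointwise_recurrent (X : topologicalType) (T : homeo X) :
  rigid T -> pointwise_recurrent T.
Proof.
move=> [m [m0 my mT]] x; exists (fun i => Posz (m i)); split; last exact: mT.
by left; exact: cvgny_int.
Qed.

Lemma uniformly_rigid_rigid (X : uniformType) (T : homeo X) :
  uniformly_rigid T -> rigid T.
Proof.
move=> [m [m0 my mT]]; exists m; split => // x.
have := @uniform_subset_cvg _ _ id setT [set x] _ _ (@subsetT _ _) mT.
rewrite uniform_set1 => Tx; exact: Tx.
Qed.

(** * Uniform rigidity in metric terms, and finite nets *)

Section metric_return.
Context {R : realType} {X : metricType R}.

(** A return time [k] of precision [e / N.+1] is repeated [N.+1] times; its bound is uniform in the
    point, so the errors add up to less than [e]. *)
Lemma uniform_return_large (f : X -> X) : uniform_return f ->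
  forall (e : R) N, 0 < e ->
  exists2 n, (N <= n)%N & forall x, mdist x (iter n f x) < e.
Proof.
move=> fr e N e0; have [|k k0 fk] := fr (e / N.+1%:R); first by rewrite divr_gt0.
exists (N.+1 * k)%N => [|x]; first by rewrite (leq_trans (leqnSn N))// leq_pmulr.
suff H j : mdist x (iter (j.+1 * k) f x) < j.+1%:R * (e / N.+1%:R).
  by have := H N; rewrite mulrC divfK.
elim: j => [|j IHj]; first by rewrite mul1n mul1r.
rewrite mulSn iterD (le_lt_trans (metric_triangle _ (iter (j.+1 * k) f x) _))//.
by rewrite -[j.+2]addn1 natrD mulrDl mul1r ltrD.
Qed.

Lemma uniform_return_inv (f g : X -> X) :
  cancel f g -> uniform_return g -> uniform_return f.
Proof.
move=> fK gr e /gr[n n0 gn]; exists n => // x.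
by have := gn (iter n f x); rewrite iter_cancel// metric_sym.
Qed.

(** Times tending to infinity come from [uniform_return_large]: the [i]-th one exceeds [i] and has
    precision [1/(i+1)]. *)
Lemma uniformly_rigidP (T : homeo X) : uniformly_rigid T <-> uniform_return T.
Proof.
split=> [[m [m0 _ mT]] e e0|Tr].
  have : \forall i \near \oo, forall x, mdist x (iter (m i) T x) < e.
    apply: (mT [set h | forall x, mdist x (h x) < e]).
    rewrite uniform_nbhs; exists [set xy | ball xy.1 e xy.2]; split.
      exact: (entourage_ball X (PosNum e0)).
    by move=> h hb x; have := hb x I; rewrite /= ballEmdist.
  by move=> /filter_ex[i]; exists (m i).
have /choice[m mP] (i : nat) : exists n, (i < n)%N /\
    forall x, mdist x (iter n T x) < i.+1%:R^-1.
  have [|n ni Tn] := uniform_return_large Tr (e := i.+1%:R^-1) i.+1.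
    by rewrite invr_gt0.
  by exists n.
exists m; split => [i||].
- by have [+ _] := mP i; exact: leq_trans.
- apply/cvgnyPge => A; near=> i; have [im _] := mP i.
  by rewrite (leq_trans _ (ltnW im))//; near: i; exact: nbhs_infty_ge.
- move=> V; rewrite uniform_nbhs => -[E [+ EV]].
  rewrite -entourage_from_ballE => -[e /= e0 eE].
  near=> i; apply: EV => x _; apply: eE => /=; rewrite ballEmdist/=.
  have [_ /(_ x)/lt_le_trans] := mP i; apply.
  by apply: ltW; near: i; exact: near_infty_natSinv_lt (PosNum e0).
Unshelve. all: by end_near. Qed.

Lemma closed_seq (s : seq X) : closed [set` s].
Proof.
apply: (iffLR accessible_finite_set_closed); last exact: finite_seq.
by apply: hausdorff_accessible; exact: metric_hausdorff.
Qed.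

Definition hyperspace_seq (s : seq X) (s0 : [set` s] !=set0) : hyperspace X :=
  Hyperspace (@closed_seq s) s0.

End metric_return.

Lemma finite_net (R : realType) (X : compactMetricType R) (e : R) : 0 < e ->
  exists s : seq X, forall x, exists2 c, c \in s & mdist c x < e.
Proof.
move=> e0; have /compact_near_coveringP cX := @compactT R X.
(* [F] is the filter of finite lists ordered by inclusion; near-covering turns the local lists
   [[:: x]] into one list for the whole space. *)
pose F := filter_from [set: seq X] (fun s => [set t : seq X | {subset s <= t}]).
have FF : ProperFilter F.
  apply: filter_from_proper; last by move=> s _; exists s => /=.
  apply: filter_fromT_filter; first by exists [::].
  move=> s t; exists (s ++ t) => u /= stu.
  by split=> x xs; apply: stu; rewrite mem_cat xs ?orbT.
have : \forall s \near F, forall x, [set: X] x -> exists2 c, c \in s & mdist c x < e.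
  apply: cX => x _; exists (ball x e, [set s | x \in s]).
    split; first exact: nbhsx_ballx.
    by exists [:: x] => // s; apply; rewrite inE.
  by move=> [y s] [/=]; rewrite ballEmdist /= => xy xs; exists x.
by move=> /filter_ex[s Hs]; exists s => x; exact: Hs.
Qed.

(** * From the return of a finite set to the return of its points *)

Section finite_return.
Context {R : realType} {X : metricType R}.
Variables (f : X -> X) (cf : continuous f).

Lemma iter_continuous n : continuous (iter n f).
Proof.
elim: n => [|n IHn] x; first exact: cvg_id.
by apply: (@continuous_comp _ _ _ (iter n f) f); [exact: IHn|exact: cf].
Qed.

(* If the times in [h] carry [x (tau i)] towards [x i], then composing [k] of
   them carries [x (tau^k i)] towards [x i]. *)
Lemma iter_return (I : finType) (x : I -> X) (tau : I -> I) :
  (forall e : R, 0 < e -> exists2 n, (0 < n)%N &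
    forall i, mdist (x i) (iter n f (x (tau i))) < e) ->
  forall k (e : R), 0 < e -> exists2 n, (k <= n)%N &
    forall i, mdist (x i) (iter n f (x (iter k tau i))) < e.
Proof.
move=> h; elim=> [|k IHk] e e0; first by exists 0%N => // i; rewrite /= mdistxx.
have e20 : 0 < e / 2 by rewrite divr_gt0.
have [n n0 fn] := h _ e20.
have : \forall d \near 0^'+, forall i y, mdist (x i) y <= d ->
    mdist (iter n f (x i)) (iter n f y) < e / 2.
  apply: filter_forall => i; apply/metricType_numDomainType.nbhsr0P.
  exact: (metricType_numDomainType.cvgr_dist_lt (@iter_continuous n (x i))).
(* The time [n] is fixed first, so [d] can be a modulus of continuity of [iter n f] at the finitely
   many [x i]; only then is [m] chosen, with precision [d]. *)
move=> cn; near (0 : R)^'+ => d.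
have [|m km fm] := IHk d; first by near: d; exact: nbhs_right_gt.
exists (n + m)%N => [|i]; first by rewrite -addn1 addnC leq_add.
rewrite (le_lt_trans (metric_triangle _ (iter n f (x (tau i))) _))//.
rewrite [e]splitr ltrD// iterD iterSr.
by apply: (near cn d) => //; exact: ltW.
Unshelve. all: by end_near. Qed.

Lemma finite_set_return (s : seq X) :
  (forall e : R, 0 < e -> exists2 n, (0 < n)%N & forall x, x \in s ->
    exists2 y, y \in s & mdist x (iter n f y) < e) ->
  simultaneous_return f s.
Proof.
move=> h; pose I := seq_sub s.
pose close (tau : {ffun I -> I}) (d : R) := exists2 n, (0 < n)%N &
  forall i, mdist (ssval i) (iter n f (ssval (tau i))) < d.
(* There are finitely many maps [tau], and failing at one precision means failing at all smaller
   ones; if each failed, a single small [d] would contradict [h]. *)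
have [tau tau_close] : exists tau, forall d : R, 0 < d -> close tau d.
  apply: contrapT => /forallNP ntau.
  have : \forall d \near 0^'+, forall tau, ~ close tau d.
    apply: filter_forall => tau.
    have /existsNP[d /not_implyP[d0 nd]] := ntau tau.
    have : \forall r \near 0^'+, r < d by exact: nbhs_right_lt.
    apply: filterS => r rd [n n0 fn]; apply: nd; exists n => // i.
    exact: lt_trans (fn i) rd.
  move=> nclose; near (0 : R)^'+ => d.
  have [|n n0 fn] := h d; first by near: d; exact: nbhs_right_gt.
  have /choice[t tP] (i : I) : exists j : I,
      mdist (ssval i) (iter n f (ssval j)) < d.
    by have [y ys iy] := fn _ (ssvalP i); exists (SeqSub ys).
  apply: (near nclose d _ [ffun i => t i]); first by [].
  by exists n => // i; rewrite ffunE.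
have tau_inj : injective tau.
  (* Were [tau i = tau j] for distinct points, one point would lie within less than half their
     distance of both. *)
  move=> i j ij; apply: val_inj => /=; apply/eqP; rewrite eq_sym.
  apply: contrapT => /negP; rewrite -mdist_gt0 => ij0.
  have [|n n0 fn] := tau_close (mdist (ssval j) (ssval i) / 2).
    by rewrite divr_gt0.
  have := metric_triangle (ssval j) (iter n f (ssval (tau j))) (ssval i).
  have := fn j; have := fn i; rewrite ij (metric_sym (iter _ _ _) (ssval i)); lra.
(* Iterating [tau] as often as its order gives the identity, and the order being positive makes [n]
   positive. *)
move=> e e0; have [n kn fn] := iter_return tau_close #[perm tau_inj]%g e0.
exists n => [|x xs]; first exact: leq_trans (order_gt0 _) kn.
have := fn (SeqSub xs).
have -> : iter #[perm tau_inj]%g tau (SeqSub xs) = SeqSub xs.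
  rewrite -[RHS](perm1 (SeqSub xs)) -(expg_order (perm tau_inj)) permX.
  by apply: eq_iter => i; rewrite permE.
by [].
Unshelve. all: by end_near. Qed.

End finite_return.

(** * Transfer of returns between a space and its hyperspace *)

Section hyperspace_return.
Context {R : realType} {X : compactMetricType R}.

Lemma hset_iter (f : X -> X) (cf : continuous f) n (A : hyperspace X) :
  hset (iter n (hyperspace_map cf) A) = iter n f @` A.
Proof.
elim: n => [|n IHn] /=; first by rewrite image_id.
by rewrite IHn image_comp.
Qed.

Lemma uniform_return_hyperspace (f : X -> X) (cf : continuous f) :
  uniform_return f -> uniform_return (hyperspace_map cf).
Proof.
move=> fr e e0; have [|n n0 fn] := fr (e / 2); first by rewrite divr_gt0.
exists n => // A; rewrite mdist_hyperspace.
apply: (@le_lt_trans _ _ (e / 2)); last by lra.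
apply: hausdorff_dist_le => x; rewrite hset_iter.
  by move=> Ax; exists (iter n f x); [exists x|exact: ltW].
by move=> [{}x Ax <-]; exists x => //; rewrite metric_sym ltW.
Qed.

(** Hausdorff closeness only matches each point of [s] with the image of some point of [s];
    [finite_set_return] upgrades this to a return of each point. *)
Lemma simultaneous_return_hyperspace_seq (f : X -> X) (cf : continuous f) (s : seq X)
    (s0 : [set` s] !=set0) :
  (forall V, nbhs (hyperspace_seq s0) V ->
     exists2 n, (0 < n)%N & V (iter n (hyperspace_map cf) (hyperspace_seq s0))) ->
  simultaneous_return f s.
Proof.
move=> h; apply: finite_set_return => // e e0.
have [n n0] := h _ (nbhsx_ballx _ e e0); rewrite ballEmdist/= => fn.
exists n => // x xs.
have [y] := hausdorff_dist_lt fn (xs : hset (hyperspace_seq s0) x).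
by rewrite hset_iter => -[z zs <-] xz; exists z.
Qed.

Lemma closed_mdist_ball (c : X) (r : R) : closed [set x | mdist c x <= r].
Proof.
move=> x clx; apply/ler_addgt0Pr => e e0.
have [y [/= cy]] := clx _ (nbhsx_ballx x e e0); rewrite ballEmdist/= => xy.
by have := metric_triangle c y x; rewrite (metric_sym y); lra.
Qed.

(** The list consists of closed balls of radius [e / 3] around a finite net. It is chosen before
    [f], so it serves both a map and its inverse; [x0] makes it non-empty. *)
Lemma closed_ball_cover (e : R) (x0 : X) : 0 < e ->
  exists2 s : seq (hyperspace X), [set` s] !=set0 &
  forall (f : X -> X) (cf : continuous f) n,
    (forall A, A \in s -> mdist A (iter n (hyperspace_map cf) A) < e / 3) ->
    forall x, mdist x (iter n f x) < e.
Proof.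
move=> e0; have e30 : 0 < e / 3 by rewrite divr_gt0.
have [s sP] := finite_net X e30.
have cb0 (c : X) : [set x : X | mdist c x <= e / 3] !=set0.
  by exists c; rewrite /= mdistxx ltW.
pose b c := Hyperspace (@closed_mdist_ball c (e / 3)) (cb0 c).
exists (map b s) => [|f cf n fn x].
  by have [c cs _] := sP x0; exists (b c); exact: map_f.
have [c cs cx] := sP x.
have := fn (b c) (map_f _ cs).
rewrite mdist_hyperspace hausdorff_dist_sym => bn.
have [|y /= cy xy] := hausdorff_dist_lt bn (x := iter n f x).
  by rewrite hset_iter; exists x => //=; exact: ltW.
(* The route goes from [x] to the centre [c], to a point [y] of the ball, to [iter n f x]; each leg
   is at most [e / 3], the first and last strictly less. *)
have := metric_triangle x c (iter n f x); have := metric_triangle c y (iter n f x).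
rewrite (metric_sym x c) (metric_sym y); lra.
Qed.

Lemma hyperspace_return_uniform (f g : X -> X) (cf : continuous f)
    (cg : continuous g) : cancel f g ->
  (forall s, [set` s] !=set0 -> simultaneous_return (hyperspace_map cf) s \/
                             simultaneous_return (hyperspace_map cg) s) ->
  uniform_return f.
Proof.
move=> fK h e e0.
have [[x0 _]|X0] := pselect ([set: X] !=set0); last first.
  by exists 1%N => // x; exfalso; apply: X0; exists x.
have [s s0 sP] := closed_ball_cover x0 e0; have e30 : 0 < e / 3 by rewrite divr_gt0.
have [/(_ _ e30)|/(_ _ e30)] := h s s0 => -[n n0 fn]; exists n => // x.
  exact: sP fn x.
(* A return of [g] that starts at [iter n f x] ends at [x], so [n] is also a return time of [f]. *)
by have := sP _ _ _ fn (iter n f x); rewrite iter_cancel// metric_sym.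
Qed.

(** The list [s] becomes one point of a power of [X], whose neighbourhoods control the finitely many
    coordinates at once. *)
Lemma weakly_rigid_return (T : homeo X) (s : seq X) : weakly_rigid T ->
  [set` s] !=set0 ->
  simultaneous_return T s \/ simultaneous_return (hinv T) s.
Proof.
move=> Tw [x0 x0s]; have s0 : (0 < size s)%N by case: s x0s.
pose x : {ptws 'I_(size s) -> X} := fun i => nth x0 s i.
have near_x (e : R) : 0 < e -> nbhs x [set y | forall i, mdist (x i) (y i) < e].
  move=> e0.
  apply: (@filter_forall _ _ (fun i (y : {ptws 'I_(size s) -> X}) =>
    mdist (x i) (y i) < e) (nbhs x) (nbhs_filter x)) => i.
  have xi : (y : {ptws 'I_(size s) -> X}) i @[y --> x] --> x i.
    exact: (@proj_continuous _ (fun=> X) i x).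
  exact: (metricType_numDomainType.cvgr_dist_lt xi).
have ret (g : X -> X) : (forall V, nbhs x V ->
    exists2 n, (0 < n)%N & V (iter n (prod_map g) x)) -> simultaneous_return g s.
  move=> xr e /near_x/xr[n n0 gn]; exists n => // y ys.
  have ys' : (index y s < size s)%N by rewrite index_mem.
  have := gn (Ordinal ys'); rewrite iter_prod_map /x /=.
  by rewrite nth_index.
by have [/ret|/ret] := recurrent_return (Tw _ s0 x); [left|right].
Qed.

End hyperspace_return.

Theorem corollary5p3 (R : realType) (X : compactMetricType R) (T : homeo X) :
  [<-> uniformly_rigid T;
       uniformly_rigid (hyperspace_homeo T);
       rigid (hyperspace_homeo T);
       weakly_rigid (hyperspace_homeo T);
       pointwise_recurrent (hyperspace_homeo (hyperspace_homeo T))].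
Proof.
have up (Y : compactMetricType R) (S : homeo Y) :
    uniformly_rigid S -> uniformly_rigid (hyperspace_homeo S).
  move=> /uniformly_rigidP Sr; apply/uniformly_rigidP.
  exact: uniform_return_hyperspace.
tfae.
- exact: up.
- exact: uniformly_rigid_rigid.
- exact: rigid_weakly_rigid.
(* Weak rigidity on K(X) is first brought down to uniform rigidity of [T], which then lifts twice,
   to K(X) and to K(K(X)). *)
- move=> KTw; apply: rigid_pointwise_recurrent; apply: uniformly_rigid_rigid.
  apply/up/up/uniformly_rigidP.
  apply: (hyperspace_return_uniform (cf := hfun_continuous T)
    (cg := hinv_continuous T) (hfunK T)) => s.
  exact: weakly_rigid_return KTw.
(* A finite list of points of K(X) is a single point of K(K(X)), and its recurrence yields returns
   in one direction of time. *)
- move=> KKTr; apply/uniformly_rigidP.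
  apply: (hyperspace_return_uniform (cf := hfun_continuous T)
    (cg := hinv_continuous T) (hfunK T)) => s s0.
  have [h|h] := recurrent_return (KKTr (hyperspace_seq s0)); [left|right].
    exact: simultaneous_return_hyperspace_seq h.
  exact: simultaneous_return_hyperspace_seq h.
Qed.
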